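(* Let $\Xi$ be the set of points of a Poisson point process in $\mathbb{R}^d$ with intensity $1$, and let $\mathcal{C}$ be the set of claimed sites for the stable allocation of $\mathbb{R}^d$ to $\Xi$ with appetite $\alpha$. (i) For every dimension $d\ge 2$ we have $\alpha_p(d)>0$; that is, there exists $\alpha_0=\alpha_0(d)>0$ such that for every $0<\alpha<\alpha_0$, almost surely there is no percolation by claimed sites (i.e., almost surely $\mathcal{C}$ has no unbounded connected subset). (ii) For every dimension $d\ge 2$ there exists $\alpha_1=\alpha_1(d)>0$ such that for every $0<\alpha<\alpha_1$, almost surely there is an unbounded connected component in $\mathbb{R}^d\setminus\mathcal{C}$.
   Context: Let $d\ge 2$, let $|\cdot|$ be the Euclidean norm and $\mathcal{L}$ the Lebesgue measure on $\mathbb{R}^d$. Elements of $\mathbb{R}^d$ are called sites and elements of $\Xi$ are called centers. Let $\alpha\in[0,+\infty]$ (the appetite). An allocation of $\mathbb{R}^d$ to $\Xi$ with appetite $\alpha$ is a measurable function $\psi:\mathbb{R}^d\to\Xi\cup\{\infty,\Delta\}$ such that $\mathcal{L}[\psi^{-1}(\Delta)]=0$ and $\mathcal{L}[\psi^{-1}(\xi)]\le\alpha$ for all $\xi\in\Xi$. The set $\psi^{-1}(\xi)$ is the territory of $\xi$. A center $\xi$ is sated if $\mathcal{L}[\psi^{-1}(\xi)]=\alpha$ and unsated otherwise. A site $x$ is claimed if $\psi(x)\in\Xi$ and unclaimed if $\psi(x)=\infty$. Let $\xi$ be a center and $x$ a site with $\psi(x)\notin\{\xi,\Delta\}$. We say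 $x$ desires $\xi$ if $|x-\xi|<|x-\psi(x)|$ or $x$ is unclaimed. We say $\xi$ covets $x$ if $|x-\xi|<|x'-\xi|$ for some $x'\in\psi^{-1}(\xi)$ or $\xi$ is unsated. The pair $(x,\xi)$ is unstable for $\psi$ if $x$ desires $\xi$ and $\xi$ covets $x$. An allocation is stable if there are no unstable pairs. It is known that for the points of a Poisson process (more generally of an ergodic point process) a stable allocation with appetite $\alpha$ exists and is almost surely unique up to $\mathcal{L}$-null sets; $\psi$ denotes this stable allocation. The set of claimed sites $\mathcal{C}$ is the closure of $\psi^{-1}(\Xi)$. There is percolation by claimed sites if there exists an unbounded connected subset of $\mathcal{C}$. The percolation threshold is $$\alpha_p(d)=\sup\{\alpha:\ \mathbf{P}[0\text{ belongs to an unbounded connected subset of }\mathcal{C}\text{ in the }d\text{-dimensional model with appetite }\alpha]=0\},$$ where the Poisson process has intensity $1$. *)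

(* Defs.v *)
From HB Require Import structures.
From mathcomp Require Import all_boot all_order all_algebra.
From mathcomp Require Import all_classical all_reals all_analysis.

Set Implicit Arguments.
Unset Strict Implicit.
Unset Printing Implicit Defensive.

Import Order.TTheory GRing.Theory Num.Theory.
Import numFieldNormedType.Exports.

Local Open Scope classical_set_scope.
Local Open Scope ring_scope.

Section euclidean_space.
Context {R : realType} {d : nat}.

(* The library norm `|x| on 'rV[R]_d is the sup norm; it has the same topology
   and the same bounded sets as the Euclidean one. *)
Definition euclidean_dist (x y : 'rV[R]_d) : R :=
  Num.sqrt (\sum_(i < d) (x 0 i - y 0 i) ^+ 2).

Definition box (c : 'rV[R]_d * 'rV[R]_d) : set 'rV[R]_d :=
  [set x | forall i, c.1 0 i <= x 0 i <= c.2 0 i].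

Definition box_volume (c : 'rV[R]_d * 'rV[R]_d) : R :=
  \prod_(i < d) Num.max 0 (c.2 0 i - c.1 0 i).

(* Lebesgue outer measure. Its restriction to the Lebesgue measurable sets
   [lebesgue.-caratheodory] is Lebesgue measure. *)
Definition lebesgue (A : set 'rV[R]_d) : \bar R :=
  ereal_inf [set \esum_(c in C) (box_volume c)%:E
            | C in [set C | countable C /\ A `<=` \bigcup_(c in C) box c]].

Lemma box_volume_ge0 c : 0 <= box_volume c.
Proof. by apply: prodr_ge0 => i _; rewrite le_max lexx. Qed.

Local Open Scope ereal_scope.

Let vol_ge0 c : 0 <= (box_volume c)%:E.
Proof. by rewrite lee_fin box_volume_ge0. Qed.

Let lebesgue_ge0 A : 0 <= lebesgue A.
Proof.
by apply: le_ereal_inf_tmp => _ [C _ <-]; apply: esum_ge0 => c _.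
Qed.

Let lebesgue0 : lebesgue set0 = 0.
Proof.
apply/eqP; rewrite eq_le lebesgue_ge0 andbT; apply: ereal_inf_lbound => /=.
by exists set0; [split => //; exact: countable0|rewrite esum_set0].
Qed.

Let le_lebesgue : {homo lebesgue : A B / A `<=` B >-> A <= B}.
Proof.
move=> A B AB; apply: ereal_inf_le_tmp => _ [C [cC BC] <-].
by exists C => //; split => //; exact: subset_trans BC.
Qed.

Let esum_bigcup_le (C : nat -> set ('rV[R]_d * 'rV[R]_d)) :
  \esum_(c in \bigcup_n C n) (box_volume c)%:E <=
  \sum_(n <oo) \esum_(c in C n) (box_volume c)%:E.
Proof.
pose D := seqDU C.
have -> : \bigcup_n C n = \bigcup_n D n by rewrite /D -seqDU_bigcup_eq.
rewrite nneseries_sum_bigcup//; last exact: trivIset_seqDU.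
apply: lee_nneseries => n _ *; first by apply: esum_ge0.
rewrite esum_mkcond [leRHS]esum_mkcond; apply: le_esum => c _.
case: ifPn => [|_]; last by case: ifPn.
by rewrite inE => -[Cc _]; rewrite mem_set.
Qed.

Let lebesgue_sigma_subadditive : sigma_subadditive lebesgue.
Proof.
move=> A; have [[i ioo]|] := pselect (exists i, lebesgue (A i) = +oo).
  by rewrite (eseries_pinfty _ _ ioo) ?leey// => n _;
    rewrite -ltNye (lt_le_trans _ (lebesgue_ge0 _)).
rewrite -forallNE => Aoo.
suff add2e (e : {posnum R}) :
    lebesgue (\bigcup_n A n) <= \sum_(i <oo) lebesgue (A i) + e%:num%:E.
  by apply/lee_addgt0Pr => _/posnumP[].
rewrite (le_trans _ (epsilon_trick _ _ _))//.
have [C PC] : {C : nat -> set ('rV[R]_d * 'rV[R]_d) & forall n,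
    [/\ countable (C n), A n `<=` \bigcup_(c in C n) box c &
      \esum_(c in C n) (box_volume c)%:E <=
      lebesgue (A n) + (e%:num / (2 ^ n.+1)%:R)%:E]}.
  apply: (@choice _ _ (fun n C => [/\ countable C,
    A n `<=` \bigcup_(c in C) box c & \esum_(c in C) (box_volume c)%:E <=
      lebesgue (A n) + (e%:num / (2 ^ n.+1)%:R)%:E])) => n.
  have Afin : lebesgue (A n) \is a fin_num.
    by rewrite ge0_fin_numE// ltey; apply/eqP.
  have en : (0 < e%:num / (2 ^ n.+1)%:R)%R by [].
  by have [_ [B [cB AB] <-] /ltW] := lb_ereal_inf_adherent en Afin; exists B.
apply: (@le_trans _ _ (\esum_(c in \bigcup_n C n) (box_volume c)%:E)).
  apply: ereal_inf_lbound; exists (\bigcup_n C n) => //; split.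
    by apply: bigcup_countable => // n _; have [] := PC n.
  move=> x [n _ /(let: And3 _ AC _ := PC n in AC x) [c Cc cx]].
  by exists c => //; exists n.
apply: (le_trans (esum_bigcup_le _)); apply: lee_nneseries => n _ *.
  by apply: esum_ge0.
by have [] := PC n.
Qed.

HB.instance Definition _ := isOuterMeasure.Build R 'rV[R]_d lebesgue
  lebesgue0 lebesgue_ge0 le_lebesgue lebesgue_sigma_subadditive.

End euclidean_space.

Section point_process.
Context {R : realType} {d : nat} {disp : measure_display}
  {Omega : measurableType disp}.
Implicit Types (B : set 'rV[R]_d) (Xi : Omega -> set 'rV[R]_d).

Definition borel_set B := <<s @open 'rV[R]_d >> B.

Definition count_event Xi B (k : nat) : set Omega :=
  [set w | (Xi w `&` B #= `I_k)%card].

(* The Poisson mass function is written out because the library's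
   [poisson_pmf r] is not the Dirac mass at 0 when r = 0. *)
Definition poisson_process (lambda : R) (P : probability Omega R) Xi : Prop :=
  [/\ forall w B, bounded_set B -> finite_set (Xi w `&` B),
      forall B k, borel_set B -> bounded_set B ->
        measurable (count_event Xi B k) /\
        let r := lambda * fine (lebesgue B) in
        P (count_event Xi B k) = (expR (- r) * r ^+ k / k`!%:R)%:E
    & forall n (B : 'I_n -> set 'rV[R]_d) (k : 'I_n -> nat),
        (forall i, borel_set (B i) /\ bounded_set (B i)) ->
        trivIset setT B ->
        P (\bigcap_(i in setT) count_event Xi (B i) (k i)) =
        (\prod_(i < n) P (count_event Xi (B i) (k i)))%E].

End point_process.

Inductive destination (S : Type) : Type :=
  | Center of S
  | Unclaimed
  | Undefined.
Arguments Unclaimed {S}.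
Arguments Undefined {S}.

Section stable_allocation.
Context {R : realType} {d : nat}.
Local Notation site := 'rV[R]_d.
Implicit Types (Xi : set site) (alpha : \bar R) (psi : site -> destination site).

Definition territory psi (xi : site) : set site := psi @^-1` [set Center xi].

(* [Xi] is countable (locally finite), so measurability of [psi] amounts to
   measurability of its fibres. [Undefined] is the value Delta. *)
Definition is_allocation Xi alpha psi : Prop :=
  [/\ forall x xi, psi x = Center xi -> Xi xi,
      forall v, lebesgue.-caratheodory (psi @^-1` [set v]),
      lebesgue (psi @^-1` [set Undefined]) = 0%E
    & forall xi, Xi xi -> (lebesgue (territory psi xi) <= alpha)%E].

Definition sated alpha psi (xi : site) : Prop :=
  lebesgue (territory psi xi) = alpha.

Definition desires psi (x xi : site) : Prop :=
  match psi x with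
  | Center eta => euclidean_dist x xi < euclidean_dist x eta
  | Unclaimed => True
  | Undefined => False
  end.

Definition covets alpha psi (xi x : site) : Prop :=
  (exists2 x', territory psi xi x' & euclidean_dist x xi < euclidean_dist x' xi)
  \/ ~ sated alpha psi xi.

Definition unstable_pair Xi alpha psi (x xi : site) : Prop :=
  [/\ Xi xi, psi x <> Center xi, psi x <> Undefined,
      desires psi x xi & covets alpha psi xi x].

Definition stable_allocation Xi alpha psi : Prop :=
  is_allocation Xi alpha psi /\
  forall x xi, ~ unstable_pair Xi alpha psi x xi.

Definition claimed_sites Xi psi : set site :=
  closure (psi @^-1` (@Center site @` Xi)).

Definition percolation Xi psi : Prop :=
  exists A : set site,
    [/\ A `<=` claimed_sites Xi psi, connected A & ~ bounded_set A].

Definition origin_percolates Xi psi : Prop :=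
  exists A : set site,
    [/\ A 0, A `<=` claimed_sites Xi psi, connected A & ~ bounded_set A].

Definition unbounded_unclaimed_component Xi psi : Prop :=
  exists2 x, (~` claimed_sites Xi psi) x &
    ~ bounded_set (connected_component (~` claimed_sites Xi psi) x).

End stable_allocation.

Section model.
Context {R : realType} {d : nat} {disp : measure_display}
  {Omega : measurableType disp}.
Implicit Types (P : probability Omega R) (Xi : Omega -> set 'rV[R]_d)
  (psi : \bar R -> Omega -> 'rV[R]_d -> destination 'rV[R]_d).

(* [psi alpha w] is the stable allocation with appetite [alpha] to [Xi w]. *)
Definition stable_allocation_model P Xi psi : Prop :=
  poisson_process 1 P Xi /\
  forall alpha, (0 <= alpha)%E ->
    {ae P, forall w, stable_allocation (Xi w) alpha (psi alpha w)}.

(* [P.-negligible] is used for "probability zero" as measurability of the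
   event is not part of the definition. The threshold depends on the model only
   through the law of [Xi w], hence only on [d]. *)
Definition percolation_threshold P Xi psi : \bar R :=
  ereal_sup [set alpha | (0 <= alpha)%E /\
    P.-negligible [set w | origin_percolates (Xi w) (psi alpha w)]].

End model.

(* Main.v *)
Require Import Defs.
From HB Require Import structures.
From mathcomp Require Import all_boot all_order all_algebra.
From mathcomp Require Import finmap.
From mathcomp Require Import all_classical all_reals all_analysis.
From mathcomp Require Import measurable_realfun.
From mathcomp Require Import zify ring lra.

Set Implicit Arguments.
Unset Strict Implicit.
Unset Printing Implicit Defensive.

Import Order.TTheory GRing.Theory Num.Theory.
Import numFieldNormedType.Exports.

Local Open Scope classical_set_scope.
Local Open Scope ring_scope.

(** Why small appetite prevents percolation.

If a center xi claims a site at distance r, stability forces every site of the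
ball of radius r around xi (up to a null set) to be claimed by a center that is
no farther from it than xi. These centers lie within 2r of xi and each serves
volume at most alpha, so some ball of radius 2r contains at least c r^d / alpha
points of the process ([claimed_crowded]). When alpha is small this density is
enormous compared with the intensity 1. The lower bound on the volume of a ball
rests on [box_volume_le_lebesgue].

Cut the space into cells of side s. A cell is overcrowded when, for some k >= 1,
the cells within distance 4k of it contain at least (k/2)^d points; every cell
that meets the closed set of claimed sites is overcrowded
([claimed_overcrowded]). The radii are unbounded and strongly dependent, and the
multiscale picture is reduced to a single union bound as follows. Along a chain
of adjacent overcrowded cells of diameter at least n, a Vitali selection
extracts disjoint cubes which carry j points in total, where j is at least a
constant times n, while the chain together with the cubes has at most a constant
times j cells. Being connected, this set of cells is visited by a walk of L j
king steps, where L depends only on d ([overcrowded_path]). There are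
only (3^d)^(L j) such walks from the origin, and the number of points seen along
one of them is a Poisson variable of mean at most a constant times j s^d, so if
s is small the probability that some walk sees j points is at most 2^-j. By
Borel-Cantelli, almost surely all but finitely many j fail ([poisson_sparse]).
Consequently chains of overcrowded cells that start within distance 2n of the
origin have diameter less than n, for all large n ([sparse_short_bad_walks]).

Everything else is deterministic. A connected set of claimed sites only visits
cells joined by a chain of overcrowded cells, hence it is bounded
([connected_bounded]). For the unclaimed component, look at the cells in a
coordinate plane. If all components were bounded, the set of good cells
connected to a large square around the origin would be bounded, and the cells
bordering it would be bad. A parity argument ([parity_crossing])
replaces the Jordan curve theorem: chains of bad cells that cross the positive
horizontal axis would reach every height, although the chain crossing at x has
diameter about x/2 at most. *)

(** * Sup-norm geometry of the integer lattice *)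

Notation lattice d := 'rV[int]_d.

Section lattice_geometry.
Context {d : nat}.
Implicit Types (p q : lattice d) (k n : nat).

Definition ldist p q : nat := (\max_(i < d) `|p 0%R i - q 0%R i|)%N.

Lemma ldist_leP p q k :
  reflect (forall i, (`|(p 0 i - q 0 i)%R| <= k)%N) (ldist p q <= k)%N.
Proof.
apply: (iffP (bigmax_leqP _ _ _)) => [H i|H i _]; first exact: H.
exact: H.
Qed.

Lemma ldistC p q : ldist p q = ldist q p.
Proof. by apply: eq_bigr => i _; rewrite distnC. Qed.

Lemma ldistxx p : ldist p p = 0%N.
Proof. by apply/eqP; rewrite -leqn0; apply/ldist_leP => i; rewrite subrr. Qed.

Lemma ldist_triangle q p r : (ldist p r <= ldist p q + ldist q r)%N.
Proof.
apply/ldist_leP => i; rewrite (leq_trans (leqD_dist _ (q 0 i) _))//.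
by rewrite leq_add//; apply/ldist_leP: i.
Qed.

Definition king : rel (lattice d) := fun p q => (ldist p q <= 1)%N.

Lemma king_refl p : king p p. Proof. by rewrite /king ldistxx. Qed.

Lemma king_sym p q : king p q = king q p. Proof. by rewrite /king ldistC. Qed.

Definition cube q k : seq (lattice d) :=
  [seq q + \row_i ((f i : nat)%:Z - k%:Z) | f : {ffun 'I_d -> 'I_(2 * k).+1}].

Lemma mem_cube q k p : (p \in cube q k) = (ldist p q <= k)%N.
Proof.
apply/fintype.imageP/ldist_leP => [[f _ ->] i|H].
  rewrite !mxE; move: (ltn_ord (f i)); move: (nat_of_ord (f i)) (q 0 i) => m z; lia.
exists [ffun i => inord `|(p 0 i - q 0 i + k%:Z)%R|%N] => //.
apply/rowP => i; rewrite !mxE ffunE inordK; have := H i;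
  move: (p 0 i) (q 0 i) => a b; lia.
Qed.

Lemma size_cube q k : size (cube q k) = ((2 * k).+1 ^ d)%N.
Proof. by rewrite size_map -cardE card_ffun !card_ord. Qed.

Lemma ldist_path a w : path king a w -> (ldist (last a w) a <= size w)%N.
Proof.
elim: w a => [|b w IHw] a /=; first by rewrite ldistxx.
case/andP => ab /IHw; rewrite king_sym in ab.
by move/leq_add/(_ ab); rewrite addn1; apply: leq_trans; apply: ldist_triangle.
Qed.

Lemma step_toward q p : p != q ->
  exists2 u, king u p & (ldist u q < ldist p q)%N.
Proof.
move=> pq; pose u : lattice d := \row_i (p 0 i - Num.sg (p 0 i - q 0 i)).
have H i : (`|(u 0 i - q 0 i)%R| <= (ldist p q).-1)%N.
  have /ldist_leP/(_ i) := leqnn (ldist p q); rewrite mxE; lia.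
exists u; first by apply/ldist_leP => i; rewrite mxE; lia.
have : (0 < ldist p q)%N.
  rewrite lt0n; apply: contra pq => /eqP pq0; apply/eqP/rowP => i.
  have /ldist_leP/(_ i) : (ldist p q <= 0)%N by rewrite pq0.
  by rewrite leqn0 absz_eq0 subr_eq0 => /eqP.
by case: ldist H => // m /ldist_leP.
Qed.

Lemma king_walk p q : exists w, [/\ path king p w, last p w = q & size w = ldist p q].
Proof.
move: {2}(ldist p q) (leqnn (ldist p q)) => m.
elim: m p => [|m IHm] p pq; have [->|npq] := eqVneq p q.
- by exists [::]; rewrite ldistxx.
- by case: (step_toward npq) => u _; move: pq; lia.
- by exists [::]; rewrite ldistxx.
have [u up uq] := step_toward npq.
have [w [pw lw sw]] : exists w, [/\ path king u w, last u w = q & size w = ldist u q].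
  by apply: IHm; lia.
exists (u :: w); split=> //=; first by rewrite king_sym up.
have := ldist_triangle u p q; rewrite /king in up; rewrite ldistC in up. lia.
Qed.

End lattice_geometry.

(** * Covering connected sets of cells by short walks *)

Section tours.
Context {T : eqType} (e : rel T).
Implicit Types (a b p q : T) (w c : seq T).

(** Detours are spliced into a walk at a vertex it visits; a walk never has to be
re-planned as more vertices have to be covered. *)
Lemma insert_tour a w b c :
  path e a w -> b \in a :: w -> path e b c -> last b c = b ->
  exists w', [/\ path e a w', size w' = (size w + size c)%N &
    {subset w ++ c <= w'}].
Proof.
move=> aw bw bc cb; case/splitPl: bw aw => w1 w2 ab.
rewrite cat_path => /andP[aw1]; rewrite ab => bw2.
exists (w1 ++ c ++ w2); split.
- by rewrite !cat_path aw1 ab bc cb.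
- by rewrite !size_cat; lia.
- by move=> x; rewrite !mem_cat => /orP[/orP[]|] ->; rewrite ?orbT.
Qed.

Hypothesis e_sym : symmetric e.

(** A doubled spanning tree: each vertex of S other than q has a neighbour in S with
a smaller value of [f], so the vertices can be removed in order of decreasing [f],
each removal costing one excursion of two steps. The length is linear in the
number of vertices, hence so is the entropy of such walks. *)
Lemma starshaped_tour (f : T -> nat) q (S : seq T) :
  {in S, forall p, p != q ->
    exists2 u, u \in S & e u p /\ (f u < f p)%N} ->
  exists c, [/\ path e q c, last q c = q, (size c <= 2 * size S)%N &
    {subset S <= q :: c}].
Proof.
move: {2}(size S) (erefl (size S)) => m; elim: m S => [|m IHm] S sS HS.
  by exists [::]; split => //; rewrite (size0nil sS).
have [v vS vmax] : exists2 v, v \in S & {in S, forall p, (f p <= f v)%N}.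
  case: S sS {HS} => // x S _; elim: S x => [|y S IHS] x.
    by exists x; rewrite ?mem_head// => p; rewrite inE => /eqP->.
  have [v vS vmax] := IHS y.
  have [xv|vx] := leqP (f x) (f v).
    exists v; first by rewrite inE vS orbT.
    by move=> p; rewrite inE => /predU1P[->//|]; exact: vmax.
  exists x; rewrite ?mem_head// => p; rewrite inE => /predU1P[->//|/vmax pv].
  exact: leq_trans pv (ltnW vx).
have remS p : p \in S -> p != v -> p \in rem v S.
  move=> pS pv; have := perm_mem (perm_to_rem vS) p.
  by rewrite pS inE (negbTE pv).
have [|p pS pq|c [qc cq sc Sc]] := IHm (rem v S).
- by rewrite size_rem// sS.
- have [u uS [up uq]] := HS p (mem_rem pS) pq.
  exists u => //; apply: remS => //; apply: contraTneq uq => ->.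
  by rewrite -leqNgt vmax// (mem_rem pS).
have vc : v \in q :: c -> {subset S <= q :: c}.
  move=> vc p pS; have [->//|pv] := eqVneq p v.
  exact/Sc/remS.
have [vq|vq] := eqVneq v q.
  exists c; split => //; last by apply: vc; rewrite vq mem_head.
  by rewrite size_rem// in sc; lia.
have [u uS [uv uq]] := HS v vS vq.
have uc : u \in q :: c.
  by apply/Sc/remS => //; apply: contraTneq uq => ->; rewrite ltnn.
(* splice the excursion u, v, u *)
case/splitPl: uc qc cq sc Sc vc => c1 c2 ecu.
rewrite cat_path last_cat ecu => /andP[qc1 uc2] cq sc Sc vc.
exists (c1 ++ [:: v, u & c2]); split.
- by rewrite cat_path qc1 ecu /= uv e_sym uv.
- by rewrite last_cat ecu.
- by move: sc; rewrite !size_cat /= size_rem// sS; lia.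
- move=> p pS; have [->|pv] := eqVneq p v.
    by rewrite inE mem_cat mem_head !orbT.
  have := Sc p (remS p pS pv); rewrite !(inE, mem_cat).
  by do ?[case/orP|move=> ->; rewrite ?orbT//].
Qed.

End tours.

Section cube_tours.
Context {d : nat}.
Implicit Types (a q : lattice d) (k n : nat).

Lemma cube_tour q k : exists c, [/\ path king q c, last q c = q,
  (size c <= 2 * (2 * k).+1 ^ d)%N & {subset cube q k <= q :: c}].
Proof.
rewrite -(size_cube q); apply: (starshaped_tour (@king_sym d) (f := ldist^~ q)) => p.
rewrite mem_cube => pk pq.
have [u up uq] := step_toward pq; exists u; last by [].
by rewrite mem_cube (leq_trans (ltnW uq)).
Qed.

Lemma insert_cubes a w (s : seq (lattice d * nat)) :
  path king a w -> {in s, forall b, b.1 \in a :: w} ->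
  exists w', [/\ path king a w',
    (size w' <= size w + \sum_(b <- s) 2 * (2 * b.2).+1 ^ d)%N,
    {subset w <= w'} & {in s, forall b, {subset cube b.1 b.2 <= a :: w'}}].
Proof.
move=> aw; elim: s => [|b s IHs] bw.
  by exists w; split => //; rewrite big_nil addn0.
have [|w1 [aw1 sw1 ww1 sw]] := IHs.
  by move=> c cs; apply: bw; rewrite inE cs orbT.
have [c [bc cb sc cc]] := cube_tour b.1 b.2.
have bw1 : b.1 \in a :: w1.
  have := bw b (mem_head _ _); rewrite !inE => /orP[->//|/ww1 ->].
  by rewrite orbT.
have [w' [aw' sw' ww']] := insert_tour aw1 bw1 bc cb.
have w1w' : {subset w1 <= w'} by move=> x xw; apply: ww'; rewrite mem_cat xw.
have aw1w' : {subset a :: w1 <= a :: w'}.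
  by move=> x; rewrite !inE => /orP[->//|/w1w' ->]; rewrite orbT.
exists w'; split => //.
- by rewrite big_cons sw' addnC addnCA leq_add// addnC.
- by move=> x /ww1/w1w'.
- move=> e; rewrite inE => /predU1P[->|es] x.
    move/cc; rewrite inE => /predU1P[->|xc]; first exact: aw1w'.
    by rewrite inE (ww' x) ?orbT// mem_cat xc orbT.
  by move/(sw e es)/aw1w'.
Qed.

End cube_tours.

(** The greedy selection of the Vitali covering lemma: take an element of largest
radius, discard all that touch it, repeat. *)
Lemma vitali_selection (I : eqType) (touch : rel I) (rad : I -> nat) (s : seq I) :
  reflexive touch ->
  exists D, [/\ {subset D <= s}, pairwise (fun i j => ~~ touch i j) D &
    {in s, forall i, exists2 j, j \in D & touch j i && (rad i <= rad j)%N}].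
Proof.
move=> tt; move: {2}(size s) (leqnn (size s)) => m.
elim: m s => [|m IHm] s sm.
  by exists [::]; split => // i; move: sm; rewrite leqn0 => /eqP/size0nil ->.
have [->|[j js jmax]] : s = [::] \/
    exists2 j, j \in s & {in s, forall i, (rad i <= rad j)%N}.
- elim: {sm} s => [|x s [->|[j js jmax]]]; first by left.
    by right; exists x; rewrite ?mem_head// => i; rewrite inE => /eqP->.
  right; have [xj|jx] := leqP (rad x) (rad j).
    exists j; first by rewrite inE js orbT.
    by move=> i; rewrite inE => /predU1P[->//|]; exact: jmax.
  exists x; rewrite ?mem_head// => i; rewrite inE => /predU1P[->//|/jmax ij].
  exact: leq_trans ij (ltnW jx).
- by exists [::]; split.
have [|D [Ds pD cD]] := IHm [seq i <- s | ~~ touch j i].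
  rewrite -ltnS (leq_trans _ sm)// size_filter -(count_predC (touch j)) addnC.
  rewrite -addn1 leq_add2l -has_count; by apply/hasP; exists j.
exists (j :: D); split.
- move=> i; rewrite inE => /predU1P[->//|/Ds].
  by rewrite mem_filter => /andP[].
- rewrite /= pD andbT; apply/allP => i /Ds.
  by rewrite mem_filter => /andP[].
- move=> i is'; have [ji|nji] := boolP (touch j i).
    by exists j; rewrite ?mem_head// ji jmax.
  have [|l lD li] := cD i; first by rewrite mem_filter nji.
  by exists l => //; rewrite inE lD orbT.
Qed.

(** * A chain of overcrowded cells yields a walk seeing many points *)

Lemma leq_expn2r m n e : (m <= n -> m ^ e <= n ^ e)%N.
Proof. by case: e => // e mn; rewrite leq_exp2r. Qed.

Section crowded_walks.
Context {d : nat} {T : eqType} (cell : T -> lattice d) (X : T -> Prop).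

(** The constants come from the cells of side s that meet the claimed sites. A site
claimed by xi at distance r < k s is within 3r, hence 3k cells, of all the points
of the ball of radius 2r around xi; the factor 4 leaves room for passing to the
closure, and 2^d absorbs the rounding of r / s up to k. *)
Definition overcrowded (q : lattice d) : Prop :=
  exists (k : nat) (t : seq T), [/\ (0 < k)%N, uniq t, (k ^ d <= 2 ^ d * size t)%N
    & {in t, forall x, X x /\ (ldist (cell x) q <= 4 * k)%N}].

(** All walks start at the origin, so that the candidates depend on l only. *)
Definition crowded_walk (l j : nat) : Prop :=
  exists (w : seq (lattice d)) (t : seq T), [/\ path king 0 w, size w = l,
    uniq t, size t = j & {in t, forall x, X x /\ cell x \in 0 :: w}].

Lemma crowded_walk_le l l' j : (l <= l')%N -> crowded_walk l j -> crowded_walk l' j.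
Proof.
move=> ll' [w [t [pw sw ut st tP]]].
exists (w ++ nseq (l' - l) (last 0 w)), t; split => //.
- rewrite cat_path pw; elim: (l' - l)%N => //= n ->.
  by rewrite king_refl.
- by rewrite size_cat size_nseq sw subnKC.
- by move=> x /tP[Xx xw]; split => //; rewrite -cat_cons mem_cat xw.
Qed.

Lemma uniq_flatten_pairwise (I : eqType) (t : I -> seq T) (D : seq I) :
  {in D, forall i, uniq (t i)} ->
  pairwise (fun i j => ~~ has [in t i] (t j)) D ->
  uniq (flatten [seq t i | i <- D]).
Proof.
elim: D => //= i D IHD tu /andP[/allP iD pD].
rewrite cat_uniq tu ?mem_head//= IHD ?andbT//; last first.
  by move=> j jD; apply: tu; rewrite inE jD orbT.
apply/hasPn => x /flatten_mapP[j /iD/hasPn/[apply]].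
by [].
Qed.

(** Let D be a Vitali selection of the cubes of radius 4k around the cells of the
path. The selected cubes are disjoint, so their points can be added up: j is the
total. The cubes of radius 8k cover the path, so the path is not longer than
34^d j (this is where 17 k >= 2 * 8k + 1 and k^d <= 2^d size t combine). The walk
goes from the origin to q, follows the path, and tours each selected cube. *)
Lemma overcrowded_path q p n :
  path king q p -> {in q :: p, forall a, overcrowded a} ->
  (n <= ldist (last q p) q)%N -> (ldist q 0 <= 2 * n)%N ->
  exists2 j, (n < 34 ^ d * j)%N & crowded_walk (5 * 34 ^ d * j) j.
Proof.
move=> qp op nq q0.
have /choice[kt ktP] : forall a, exists kt : nat * seq T, a \in q :: p ->
    [/\ (0 < kt.1)%N, uniq kt.2, (kt.1 ^ d <= 2 ^ d * size kt.2)%N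
    & {in kt.2, forall x, X x /\ (ldist (cell x) a <= 4 * kt.1)%N}].
  move=> a; have [aq|_] := boolP (a \in q :: p); last by exists (0%N, [::]).
  by have [k [t H]] := op a aq; exists (k, t).
pose k a := (kt a).1; pose t a := (kt a).2.
case/shortenP: qp nq => p' qp' up' sp' nq.
have n_le : (n <= size p')%N := leq_trans nq (ldist_path qp').
have sub : {subset q :: p' <= q :: p}.
  by move=> a; rewrite !inE => /orP[->//|/sp' ->]; rewrite orbT.
have [|D [Dp pD cD]] := @vitali_selection _
  (fun a b => ldist a b <= 4 * (k a + k b))%N k (q :: p').
  by move=> a; rewrite ldistxx.
have kD a : a \in D -> ((17 * k a) ^ d <= 34 ^ d * size (t a))%N.
  move=> /Dp/sub/ktP[_ _ ka _]; rewrite expnMn (_ : 34 = 17 * 2)%N//.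
  by rewrite expnMn -mulnA leq_mul2l ka orbT.
have k0 a : a \in D -> (0 < k a)%N by move=> /Dp/sub/ktP[].
pose ts := flatten [seq t a | a <- D]; pose j := size ts.
have jE : j = \sum_(a <- D) size (t a).
  by rewrite /j size_flatten sumnE /shape -map_comp big_map.
have sumD (F : lattice d -> nat) c :
    {in D, forall a, F a <= c * (34 ^ d * size (t a))}%N ->
    (\sum_(a <- D) F a <= c * (34 ^ d * j))%N.
  move=> FD; rewrite jE !big_distrr/= big_seq [leqRHS]big_seq.
  exact: leq_sum.
(* the cubes of radius 8k around the selected cells cover the path *)
have size_p' : (size p' < 34 ^ d * j)%N.
  have : {subset q :: p' <= flatten [seq cube a (8 * k a) | a <- D]}.
    move=> b /cD[a aD /andP[ab ba]]; apply/flatten_mapP; exists a => //.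
    rewrite mem_cube ldistC (leq_trans ab)//.
    by move: ba; move: (k a) (k b) => ka kb; lia.
  move/(uniq_leq_size up') => /leq_trans; apply.
  rewrite size_flatten sumnE /shape -map_comp big_map -[leqRHS]mul1n.
  apply: sumD => a aD /=; rewrite size_cube mul1n (leq_trans _ (kD a aD))//.
  by apply: leq_expn2r; have := k0 a aD; lia.
have [w0 [pw0 w0q sw0]] := king_walk 0 q.
have pw : path king 0 (w0 ++ p') by rewrite cat_path pw0 w0q.
have [|w [aw sw _ sww]] := insert_cubes pw (s := [seq (a, 4 * k a)%N | a <- D]).
  move=> _ /mapP[a /Dp aD ->] /=; rewrite -cat_cons mem_cat.
  move: aD; rewrite inE => /predU1P[->|->]; last by rewrite orbT.
  by rewrite -w0q mem_last.
exists j; first exact: leq_ltn_trans n_le size_p'.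
apply: (@crowded_walk_le (size w)).
  apply: leq_trans sw _; rewrite big_map size_cat sw0 ldistC.
  have : (\sum_(a <- D) 2 * (2 * (4 * k a)).+1 ^ d <= 2 * (34 ^ d * j))%N.
    apply: sumD.
    move=> a aD; rewrite leq_mul2l (leq_trans _ (kD a aD)) ?orbT//.
    by apply: leq_expn2r; have := k0 a aD; move: (k a) => c; lia.
  rewrite /= -mulnA; move: size_p' n_le q0.
  by move: (34 ^ d * j)%N (\sum_(_ <- _) _)%N (size p') (ldist _ _); lia.
exists w, ts; split => //.
- apply: uniq_flatten_pairwise => [a /Dp/sub/ktP[]//|].
  move: pD; apply: (@sub_in_pairwise _ (mem D)); last exact/allP.
  move=> a b aD bD /=; apply: contraNN => /hasP[x xb xa].
  have [_ _ _ /(_ x xa)[_ xacell]] := ktP a (sub _ (Dp _ aD)).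
  have [_ _ _ /(_ x xb)[_ xbcell]] := ktP b (sub _ (Dp _ bD)).
  rewrite mulnDr (leq_trans (ldist_triangle (cell x) _ _))// leq_add//.
  by rewrite ldistC.
- move=> x /flatten_mapP[a aD xa]; have [_ _ _ /(_ x xa)[Xx xcell]] :=
    ktP a (sub _ (Dp _ aD)).
  split => //; apply: (sww (a, 4 * k a)%N); last by rewrite mem_cube.
  by apply/mapP; exists a.
Qed.

End crowded_walks.

(** * Lebesgue outer measure of boxes *)

Section box_volume_lower_bound.
Context {R : realType}.

Lemma lebesgue_measure_cc (a b : R) :
  lebesgue_measure (`[a, b]%classic : set R) = (Num.max 0 (b - a))%:E.
Proof.
rewrite lebesgue_measure_itv/= lte_fin; case: ltP => ab.
  by rewrite EFinN max_r// subr_ge0 ltW.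
by rewrite max_l// subr_le0.
Qed.

(** Integration one coordinate at a time. For a fixed last coordinate t the slices
satisfy the same hypothesis, with the weights of the boxes that the slice misses
set to 0; integrating the conclusion over t gives the step. The weights are what
makes the induction go through, and monotone convergence handles countable covers
without any compactness argument. *)
Lemma volume_le_weighted_cover (m : nat) (a b : nat -> R) (l u : nat -> nat -> R)
    (v : nat -> R) : (forall n, 0 <= v n) ->
  (forall x : nat -> R, (forall i, (i < m)%N -> a i <= x i <= b i) ->
    (1 <= \sum_(n <oo) (v n * \prod_(i < m) (l n i <= x i <= u n i)%R%:R)%:E)%E) ->
  ((\prod_(i < m) Num.max 0 (b i - a i))%:E <=
    \sum_(n <oo) (v n * \prod_(i < m) Num.max 0 (u n i - l n i))%:E)%E.
Proof.
elim: m v => [|m IHm] v v0 cover.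
  rewrite big_ord0; apply: le_trans (cover a _) _ => //.
  by apply: lee_nneseries => n _ *; rewrite !big_ord0 ?lee_fin ?mulr1.
pose V := \prod_(i < m) Num.max 0 (b i - a i).
pose W n := v n * \prod_(i < m) Num.max 0 (u n i - l n i).
have W0 n : 0 <= W n.
  by rewrite mulr_ge0// prodr_ge0// => i _; rewrite le_max lexx.
have V0 : 0 <= V by rewrite prodr_ge0// => i _; rewrite le_max lexx.
pose D : set R := `[a m, b m]%classic.
have slice t : D t ->
    (V%:E <= \sum_(n <oo) (W n * \1_(`[l n m, u n m]%classic) t)%:E)%E.
  rewrite /D/= in_itv/= => Dt.
  rewrite (_ : (fun n => _) = (fun n => \sum_(0 <= k < n)
      (v k * (l k m <= t <= u k m)%R%:R *
       \prod_(i < m) Num.max 0 (u k i - l k i))%:E)%E); last first.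
    apply/funext => n; apply: eq_bigr => k _; rewrite /W mulrAC indicE.
    by rewrite mem_setE in_itv.
  apply: IHm => [n|x xab]; first by rewrite mulr_ge0.
  pose x' i := if i == m then t else x i.
  have x'ab i : (i < m.+1)%N -> a i <= x' i <= b i.
    rewrite /x'; case: eqP => [->//|/eqP im].
    by rewrite ltnS leq_eqVlt (negbTE im); exact: xab.
  apply: (le_trans (cover x' x'ab)); rewrite le_eqVlt; apply/orP; left; apply/eqP.
  congr (limn _); apply/funext => n; apply: eq_bigr => k _; congr EFin.
  rewrite big_ord_recr/= /x' eqxx [RHS]mulrAC mulrA; congr (_ * _ * _).
  by apply: eq_bigr => i _; rewrite ltn_eqF.
rewrite big_ord_recr/= -/V EFinM -lebesgue_measure_cc.
rewrite -(integral_cst lebesgue_measure (measurable_itv _)).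
have mI n : measurable_fun D
    (fun t : R => (W n * \1_(`[l n m, u n m]%classic) t)%:E : \bar R).
  apply/measurable_EFinP; apply: measurable_funM; first exact: measurable_cst.
  exact: measurable_indic.
have I0 n t : D t -> (0 <= (W n * \1_(`[l n m, u n m]%classic) t)%:E)%E.
  by move=> _; rewrite lee_fin mulr_ge0.
apply: (@le_trans _ _ (\int[lebesgue_measure]_(t in D)
    (\sum_(n <oo) (W n * \1_(`[l n m, u n m]%classic) t)%:E)%E)%E).
  apply: ge0_le_integral => //=; try exact: measurable_itv.
  by apply: ge0_emeasurable_sum => [n t Dt _|n _]; [exact: I0|exact: mI].
rewrite integral_nneseries//; last exact: measurable_itv.
apply: lee_nneseries => n _ *; first by apply: integral_ge0 => t; exact: I0.
under eq_integral do rewrite EFinM.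
rewrite ge0_integralZl_EFin//; last 2 first.
- exact: measurable_itv.
- by apply/measurable_EFinP; exact: measurable_indic.
rewrite integral_indic//; try exact: measurable_itv.
rewrite big_ord_recr/= mulrA -/(W n) [leRHS]EFinM lee_wpmul2l ?lee_fin//.
rewrite -lebesgue_measure_cc le_measure ?inE//.
by apply: measurableI; exact: measurable_itv.
Qed.

Context {d : nat}.
Implicit Types (x : 'rV[R]_d) (c : 'rV[R]_d * 'rV[R]_d).

Let coord x (k : nat) : R := oapp (x 0) 0 (insub k).

Let coordE x (i : 'I_d) : coord x i = x 0 i.
Proof. by rewrite /coord valK. Qed.

Lemma box_volume_le_lebesgue c : ((box_volume c)%:E <= lebesgue (box c))%E.
Proof.
apply: le_ereal_inf_tmp => _ [C [/countable_bijP[B BC] cC] <-].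
move: BC; rewrite card_eq_sym => /card_set_bijP[e eBC].
rewrite (reindex_esum _ _ _ _ eBC) esum_mkcond -nneseries_esumT; last first.
  by move=> n; case: ifP => // _; rewrite lee_fin box_volume_ge0.
have H := @volume_le_weighted_cover d (coord c.1) (coord c.2)
  (fun n => coord (e n).1) (fun n => coord (e n).2) (fun n => (n \in B)%:R)
  (fun _ => ler0n _ _).
rewrite /box_volume (eq_bigr (fun i : 'I_d =>
    Num.max 0 (coord c.2 i - coord c.1 i))); last first.
  by move=> i _; rewrite !coordE.
apply: (le_trans (H _)) => {H}; last first.
  apply: lee_nneseries => n _ *.
    by rewrite lee_fin mulr_ge0// prodr_ge0// => i _; rewrite le_max lexx.
  under eq_bigr do rewrite !coordE.
  by case: ifP => nB; rewrite ?mul1r ?mul0r.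
move=> x xc.
pose y : 'rV[R]_d := \row_i x i.
have [|a Ca ya] := cC y.
  by move=> i; rewrite mxE; have := xc i (ltn_ord i); rewrite !coordE.
have [_ _ /(_ a Ca)[n Bn en]] := eBC.
apply: (@le_trans _ _ ((n \in B)%:R * \prod_(i < d)
  (coord (e n).1 i <= x i <= coord (e n).2 i)%R%:R)%:E).
  rewrite mem_set// mul1r big1// => i _; rewrite !coordE en.
  by have := ya i; rewrite mxE => ->.
rewrite (@nneseriesD1 _ _ n)//; last first.
  by move=> k _; rewrite lee_fin mulr_ge0// prodr_ge0.
rewrite leeDl// nneseries_ge0// => k _ _.
by rewrite lee_fin mulr_ge0// prodr_ge0.
Qed.

Lemma lebesgue_le_box_volume (A : set 'rV[R]_d) c :
  A `<=` box c -> (lebesgue A <= (box_volume c)%:E)%E.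
Proof.
move=> Ac; apply: ereal_inf_lbound => /=; exists [set c].
  by split; [exact: countable1|move=> x /Ac; exists c].
by rewrite esum_set1// lee_fin box_volume_ge0.
Qed.

End box_volume_lower_bound.

(** * Cells of the grid of side s *)

Section cells.
Context {R : realType} {d : nat}.
Implicit Types (x y : 'rV[R]_d) (s : R) (q : lattice d) (S : seq (lattice d)).

Lemma rV_norm_le x (M : R) : 0 <= M ->
  reflect (forall i, `|x 0 i| <= M) (`|x| <= M).
Proof.
move=> M0; rewrite [leLHS]mx_normrE; apply: (iffP (bigmax_leP _ _ _ _)) => /=.
  by move=> [_ H] i; exact: (H (0, i)).
by move=> H; split => // -[i j] _ /=; rewrite (ord1 i).
Qed.

Lemma rV_coord_le x i : `|x 0 i| <= `|x|.
Proof. by move: i; apply/rV_norm_le. Qed.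

Definition cell s x : lattice d := \row_i Num.floor (x 0 i / s).

Lemma cellP s x q : 0 < s -> reflect
  (forall i, s * (q 0 i)%:~R <= x 0 i < s * (q 0 i + 1)%:~R) (cell s x == q).
Proof.
move=> s0; apply: (iffP eqP) => [<- i|H].
  have := floor_itv (x 0 i / s); rewrite mxE.
  by rewrite ler_pdivlMr// ltr_pdivrMr// ![s * _]mulrC.
apply/rowP => i; rewrite mxE; apply: floor_def.
by rewrite ler_pdivlMr// ltr_pdivrMr// ![_ * s]mulrC.
Qed.

Lemma ldist_cell s x y (k : nat) : 0 < s ->
  (forall i, `|x 0 i - y 0 i| < s * k%:R) -> (ldist (cell s x) (cell s y) <= k)%N.
Proof.
move=> s0 xy; apply/ldist_leP => i; rewrite !mxE.
have step (a b : R) : a < b + s * k%:R ->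
    Num.floor (a / s) <= Num.floor (b / s) + k%:Z.
  move=> ab; rewrite -[k%:Z](@intrKfloor R) -floorDrz ?intr_int//.
  by apply: le_floor; rewrite ler_pdivrMr// mulrDl divfK ?gt_eqF// ltW// mulrC.
have := xy i; rewrite ltr_norml => /andP[yx {}xy].
have H1 := step (x 0 i) (y 0 i); have H2 := step (y 0 i) (x 0 i).
have := H1 ltac:(lra); have := H2 ltac:(lra).
move: (Num.floor _) (Num.floor _) => u v; lia.
Qed.

Definition region s S : set 'rV[R]_d := [set x | cell s x \in S].

Lemma region_cons s q S : region s (q :: S) = region s [:: q] `|` region s S.
Proof.
apply/seteqP; split => x; rewrite /region /= !inE; first by move=> /orP[]; tauto.
by case=> [->//|->]; rewrite orbT.
Qed.

Lemma region_cell_itv s q : 0 < s -> region s [:: q] =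
  \bigcap_(i in [set: 'I_d]) ((fun x => x 0 i) @^-1` [set a | s * (q 0 i)%:~R <= a] `&`
     (fun x => x 0 i) @^-1` [set a | a < s * (q 0 i + 1)%:~R]).
Proof.
move=> s0; apply/seteqP; split => x; rewrite /region /= inE.
  by move=> /cellP-/(_ s0) H i _ /=; have /andP[] := H i.
by move=> H; apply/cellP => // i; have [/= -> ->] := H i I.
Qed.

Lemma open_halfspace (i : 'I_d) (c : R) :
  open ((fun x : 'rV[R]_d => x 0 i) @^-1` [set a | a < c]).
Proof.
by apply: open_comp => [x _|]; [exact: coord_continuous|exact: open_lt].
Qed.

Lemma borel_region s S : 0 < s -> borel_set (region s S).
Proof.
move=> s0; rewrite /borel_set.
rewrite -[<<s _ >>]/(@measurable _ (g_sigma_algebraType (@open 'rV[R]_d))).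
have mo (A : set (g_sigma_algebraType (@open 'rV[R]_d))) :
  @open 'rV[R]_d A -> measurable A by exact: sub_sigma_algebra.
elim: S => [|q S IHS].
  by rewrite (_ : region _ _ = set0)//; apply/seteqP; split.
rewrite region_cons; apply: measurableU => //; rewrite region_cell_itv//.
apply: fin_bigcap_measurable => // i _; apply: measurableI.
  rewrite (_ : _ @^-1` _ = ~` ((fun x : 'rV[R]_d => x 0 i) @^-1`
      [set a | a < s * (q 0 i)%:~R])); last first.
    apply/seteqP; split => x /=; first by rewrite leNgt => /negP.
    by move/negP; rewrite -leNgt.
  by apply: measurableC; apply: mo; exact: (@open_halfspace i).
by apply: mo; exact: (@open_halfspace i).
Qed.

Lemma region_cell_sub s q : 0 < s ->
  region s [:: q] `<=` box (\row_i (s * (q 0 i)%:~R), \row_i (s * (q 0 i + 1)%:~R)).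
Proof.
move=> s0 x; rewrite region_cell_itv// => H i; rewrite !mxE.
by have [/= -> /ltW ->] := H i I.
Qed.

Lemma lebesgue_region s S : 0 < s ->
  (lebesgue (region s S) <= ((size S)%:R * s ^+ d)%:E)%E.
Proof.
move=> s0; elim: S => [|q S IHS].
  by rewrite (_ : region _ _ = set0) ?outer_measure0 ?mul0r//; apply/seteqP; split.
rewrite region_cons (le_trans (outer_measureU2 _ _ _))//.
rewrite [size _]/= -natr1 mulrDl EFinD addeC leeD// mul1r.
rewrite (le_trans (lebesgue_le_box_volume (region_cell_sub s0)))// lee_fin.
rewrite /box_volume /= (eq_bigr (fun => s)) ?prodr_const ?card_ord// => i _.
by rewrite !mxE intrD mulrDr mulr1 addrAC subrr add0r max_r// ltW.
Qed.

Lemma bounded_region s S : 0 < s -> bounded_set (region s S).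
Proof.
move=> s0; pose M := s * (\sum_(q <- S) ldist q 0 + 1)%:R.
exists M; split; first exact: num_real.
move=> b Mb x; rewrite /region /= => xS; apply: le_trans (ltW Mb).
apply/rV_norm_le => [|i]; first by rewrite mulr_ge0// ltW.
have /cellP-/(_ s0 i) := eqxx (cell s x).
move: (cell s x) xS => q xS; have := leqnn (ldist q 0) => /ldist_leP/(_ i).
have -> : (0 : lattice d) 0 i = 0 by rewrite mxE.
rewrite subr0 => qi.
have : (ldist q 0 <= \sum_(q <- S) ldist q 0)%N by rewrite (big_rem q)//= leq_addr.
move=> /(leq_trans qi) {qi}; rewrite /M; move: (q 0 i) (\sum_(q <- S) _)%N => z m zm.
have : (- m%:Z <= z <= m%:Z)%R by lia.
rewrite -!(ler_int R) => /andP[z1 z2] /andP[x1 x2].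
rewrite natrD mulrDr mulr1; move: x1 x2; rewrite intrD mulrDr mulr1.
have := ler_wpM2l (ltW s0) z1; have := ler_wpM2l (ltW s0) z2.
by rewrite mulrNz mulrN ler_norml; lra.
Qed.

End cells.

(** * Poisson processes are sparse along all long walks *)

Section poisson_tail.
Context {R : realType}.
Implicit Types (r : R) (j k : nat).

Lemma nneseries_exp_coeff r : 0 <= r ->
  (\sum_(k <oo) (r ^+ k / k`!%:R)%:E)%E = (expR r)%:E.
Proof.
move=> r0; rewrite /expR -EFin_lim; last exact: is_cvg_series_exp_coeff.
by apply/congr_lim/funext => n /=; rewrite /series/= -sumEFin.
Qed.

(** Chernoff-type bound without optimisation: (j + k)! >= j! k! lets the factor
r^j / j! be pulled out of the tail, and the remaining sum is at most 1. The
bound is monotone in r, so an upper bound on the volume is enough. *)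
Lemma poisson_tail r j : 0 <= r ->
  (\sum_(k <oo) (expR (- r) * r ^+ (j + k) / (j + k)`!%:R)%:E <=
    (r ^+ j / j`!%:R)%:E)%E.
Proof.
move=> r0; pose c := expR (- r) * (r ^+ j / j`!%:R).
have c0 : 0 <= c by rewrite mulr_ge0 ?expR_ge0// divr_ge0// exprn_ge0.
apply: (@le_trans _ _ (\sum_(k <oo) c%:E * (r ^+ k / k`!%:R)%:E)%E).
  apply: lee_nneseries => k _ *.
    by rewrite lee_fin divr_ge0// mulr_ge0 ?expR_ge0// exprn_ge0.
  have -> : (c%:E * (r ^+ k / k`!%:R)%:E)%E =
      (expR (- r) * r ^+ (j + k) * (j`!%:R * k`!%:R)^-1)%:E.
    by rewrite -EFinM /c exprD invfM; congr (_%:E); ring.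
  rewrite lee_fin ler_wpM2l ?mulr_ge0 ?expR_ge0 ?exprn_ge0//.
  rewrite lef_pV2 ?posrE ?mulr_gt0 ?ltr0n ?fact_gt0//.
  rewrite -natrM ler_nat -(bin_fact (leq_addr k j)) addKn.
  by rewrite leq_pmull// bin_gt0 leq_addr.
rewrite nneseriesZl; last by move=> k _; rewrite lee_fin divr_ge0// exprn_ge0.
rewrite nneseries_exp_coeff// -EFinM lee_fin /c mulrAC expRN mulVf ?mul1r//.
by rewrite gt_eqF// expR_gt0.
Qed.

Lemma exprn_fact_le j : j%:R ^+ j / j`!%:R <= expR 1 ^+ j :> R.
Proof.
rewrite -expRM_natl mulr1; case: j => [|j]; first by rewrite expr0 fact0 divr1 expR0.
by apply: le_trans (expR_ge1Dxn j _) => //; rewrite lerDr.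
Qed.

End poisson_tail.

Section walk_enumeration.
Context {d : nat}.

Fixpoint king_walks (a : lattice d) (n : nat) : seq (seq (lattice d)) :=
  if n is m.+1 then [seq b :: w | b <- cube a 1, w <- king_walks b m]
  else [:: [::]].

Lemma mem_king_walks a w : path king a w -> w \in king_walks a (size w).
Proof.
elim: w a => //= b w IHw a /andP[ab bw].
apply/allpairsPdep; exists b, w; split => //; last exact: IHw.
by rewrite mem_cube; move: ab; rewrite king_sym.
Qed.

Lemma king_walks_size a n w : w \in king_walks a n -> size w = n.
Proof.
elim: n a w => [|n IHn] a w /=; first by rewrite inE => /eqP->.
by case/allpairsPdep => b [v [_ /IHn <- ->]].
Qed.

Lemma size_king_walks a n : size (king_walks a n) = ((3 ^ d) ^ n)%N.
Proof.
elim: n a => //= n IHn a.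
rewrite size_allpairs_dep (eq_map (fun b => IHn b)).
by rewrite sumnE big_map big_const_seq count_predT iter_addn_0 mulnC size_cube expnS.
Qed.

End walk_enumeration.

Section sparsity.
Context {R : realType} {d : nat}.
Implicit Types (s r : R).

Lemma size_uniq_card (T : choiceType) (A : set T) (t : seq T) k :
  uniq t -> {in t, forall x, A x} -> (A #= `I_k)%card -> (size t <= k)%N.
Proof.
move=> ut tA Ak; rewrite -(card_fset_set Ak).
have fA : finite_set A by exists k.
apply: uniq_leq_size => // x /tA Ax.
by rewrite in_fset_set// inE.
Qed.

Context {disp : measure_display} {Omega : measurableType disp}
  (P : probability Omega R).

Lemma measure_bigsetU_le (I : eqType) (W : seq I) (F : I -> set Omega) c :
  (forall i, measurable (F i)) -> {in W, forall i, (P (F i) <= c%:E)%E} ->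
  (P (\big[setU/set0]_(i <- W) F i) <= ((size W)%:R * c)%:E)%E.
Proof.
move=> mF; elim: W => [|i W IHW] Fc; first by rewrite big_nil measure0 mul0r.
rewrite big_cons (le_trans (measureU2 _ _ _))//; first by apply: bigsetU_measurable.
rewrite /= -natr1 mulrDl EFinD addeC leeD ?mul1r ?Fc ?mem_head// IHW// => k kW.
by rewrite Fc// inE kW orbT.
Qed.

Context (Xi : Omega -> set 'rV[R]_d).
Hypothesis Poi : poisson_process 1 P Xi.

Definition at_least (B : set 'rV[R]_d) j : set Omega :=
  \bigcup_k count_event Xi B (j + k).

Lemma at_least_measurable B j : borel_set B -> bounded_set B ->
  measurable (at_least B j).
Proof.
move=> mB bB; apply: bigcup_measurable => k _.
by have [_ /(_ B (j + k)%N mB bB)[]] := Poi.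
Qed.

Lemma at_least_le B j r : borel_set B -> bounded_set B ->
  (lebesgue B <= r%:E)%E -> (P (at_least B j) <= (r ^+ j / j`!%:R)%:E)%E.
Proof.
move=> mB bB Br.
have fB : lebesgue B \is a fin_num.
  by rewrite ge0_fin_numE ?outer_measure_ge0// (le_lt_trans Br)// ltry.
set l := fine (lebesgue B).
have l0 : 0 <= l by rewrite fine_ge0// outer_measure_ge0.
have lr : l <= r by rewrite -lee_fin fineK.
apply: (@le_trans _ _ (l ^+ j / j`!%:R)%:E); last first.
  by rewrite lee_fin ler_wpM2r// lerXn2r// nnegrE (le_trans l0).
apply: le_trans (poisson_tail j l0).
have H k := (let: And3 _ H _ := Poi in H B (j + k)%N mB bB).
rewrite (le_trans (@measure_sigma_subadditive _ _ _ P _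
  (fun k => count_event Xi B (j + k)) _ _ _))//.
- by move=> k; have [] := H k.
- exact: at_least_measurable.
apply: lee_nneseries => // k _ *.
by have [_ /= ->] := H k; rewrite mul1r.
Qed.

Lemma crowded_walk_sub s l j : 0 < s ->
  [set w | crowded_walk (cell s) (Xi w) l j] `<=`
  \big[setU/set0]_(p <- king_walks 0 l) at_least (region s (0 :: p)) j.
Proof.
move=> s0 w [p [t [p0 pl ut <- tP]]].
rewrite -bigcup_seq; exists p => /=; first by rewrite -pl mem_king_walks.
have [k Hk] : finite_set (Xi w `&` region s (0 :: p)).
  by have [+ _ _] := Poi; apply; exact: bounded_region.
exists (k - size t)%N => //; rewrite /count_event /= subnKC//.
by apply: size_uniq_card ut _ Hk => x /tP.
Qed.

End sparsity.

(** The walk bound against the Poisson bound. A walk of L j steps, with j > 0, meets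
at most L j + 1 cells, of volume at most (L + 1) j s, so it sees j points with
probability at most ((L + 1) s j)^j / j! <= ((L + 1) s e)^j; there are 3^(d L j)
walks. The side s makes the product of these bounds at most 2^-j. *)
Lemma poisson_sparse (R : realType) (d L : nat) : (0 < d)%N ->
  exists2 s : R, 0 < s &
  forall (disp : measure_display) (Omega : measurableType disp)
    (P : probability Omega R) (Xi : Omega -> set 'rV[R]_d),
  poisson_process 1 P Xi ->
  {ae P, forall w, exists J, forall j, (J <= j)%N ->
    ~ crowded_walk (cell s) (Xi w) (L * j) j}.
Proof.
move=> d0; pose D : R := ((3 ^ d) ^ L)%:R * L.+1%:R * expR 1.
have D0 : 0 < D by rewrite !mulr_gt0 ?expR_gt0// ltr0n !expn_gt0.
pose s : R := Num.min 1 (2 * D)^-1.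
have s0 : 0 < s by rewrite lt_min ltr01 invr_gt0 mulr_gt0.
have s_le1 : s <= 1 by rewrite /s ge_min lexx.
have sD : s <= (2 * D)^-1 by rewrite /s ge_min lexx orbT.
have s1 : s ^+ d <= s by rewrite -[leRHS]expr1 ler_wiXn2l// ltW.
have Ds : D * s <= 2^-1 by rewrite -ler_pdivlMl// -invfM (mulrC D).
exists s => // disp Omega P Xi Poi.
pose M j : set Omega := \big[setU/set0]_(p <- king_walks (0 : lattice d) (L * j))
  at_least Xi (region s (0 :: p)) j.
have mF j p : measurable (at_least Xi (region s (0 :: p)) j).
  by apply: (at_least_measurable Poi); [exact: borel_region|exact: bounded_region].
have mM j : measurable (M j) by apply: bigsetU_measurable.
have PM j : (P (M j) <= (2 / (2 ^ j.+1)%:R)%:E)%E.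
  have -> : 2 / (2 ^ j.+1)%:R = 2^-1 ^+ j :> R.
    by rewrite expnS natrM invfM mulrA divff// mul1r natrX exprVn.
  case: j => [|j]; first by rewrite expr0 probability_le1.
  set i := j.+1; pose r : R := L.+1%:R * s * i%:R.
  have := @measure_bigsetU_le _ _ _ P _ (king_walks (0 : lattice d) (L * i))
    (fun p => at_least Xi (region s (0 :: p)) i) (r ^+ i / i`!%:R) (mF i).
  rewrite size_king_walks => H; apply: (le_trans (H _)) => {H} [p /king_walks_size sp|].
    apply: (at_least_le Poi); [exact: borel_region|exact: bounded_region|].
    apply: le_trans (lebesgue_region _ s0) _; rewrite lee_fin /= sp /r mulrAC.
    rewrite -natrM; apply: ler_pM => //; first by rewrite exprn_ge0 ?ltW.
    by rewrite ler_nat mulSn addnC -addn1 leq_add.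
  rewrite lee_fin expnM natrX /r exprMn -mulrA.
  apply: (@le_trans _ _ ((D * s) ^+ i)); last first.
    by apply: lerXn2r => //; rewrite nnegrE ?mulr_ge0 ?(ltW s0) ?(ltW D0).
  have -> : D * s = ((3 ^ d) ^ L)%:R * ((L.+1%:R * s) * expR 1) by rewrite /D; ring.
  rewrite [X in _ <= X]exprMn [X in _ <= _ * X]exprMn.
  rewrite ler_wpM2l ?exprn_ge0// ler_wpM2l ?exprn_fact_le//.
  by rewrite exprn_ge0// mulr_ge0// ltW.
exists (lim_sup_set M); split.
- by apply: bigcap_measurable => // n _; exact: bigcup_measurable.
- apply: lim_sup_set_cvg0 => //; apply: (@le_lt_trans _ _ 2%:E); last exact: ltry.
  apply: le_trans (epsilon_trick0 xpredT (ler0n R 2)).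
  by apply: lee_nneseries => // j _ *; exact: PM.
- move=> w /= nw n _; apply: contra_notP nw => nM; exists n => j nj cw.
  by apply: nM; exists j => //; exact: (crowded_walk_sub Poi).
Qed.

(** * Claimed sites lie in overcrowded cells *)

Section claimed_sites_are_overcrowded.
Context {R : realType} {d : nat}.
Implicit Types (x y z xi eta : 'rV[R]_d) (r s : R).

Lemma coord_le_euclidean_dist x y i : `|x 0 i - y 0 i| <= euclidean_dist x y.
Proof.
rewrite -sqrtr_sqr ler_wsqrtr// (bigD1 i)//= lerDl.
by apply: sumr_ge0 => k _; exact: sqr_ge0.
Qed.

Lemma euclidean_dist_lt x y r : (0 < d)%N -> 0 < r ->
  (forall i, `|x 0 i - y 0 i| <= r / (2 * d%:R)) -> euclidean_dist x y < r.
Proof.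
move=> d0 r0 H; have dR : 1 <= d%:R :> R by rewrite ler1n.
rewrite -[ltRHS](ger0_norm (ltW r0)) -sqrtr_sqr ltr_sqrt ?exprn_gt0//.
apply: (@le_lt_trans _ _ (\sum_(i < d) (r / (2 * d%:R)) ^+ 2)).
  apply: ler_sum => i _; rewrite -[leLHS]real_normK ?num_real//.
  by rewrite lerXn2r ?nnegrE ?divr_ge0 ?mulr_ge0// ltW.
rewrite sumr_const card_ord -[ltLHS]mulr_natr.
have -> : (r / (2 * d%:R)) ^+ 2 * d%:R = r ^+ 2 / (4 * d%:R).
  by field; rewrite gt_eqF// (lt_le_trans ltr01).
rewrite ltr_pdivrMr; last by lra.
by rewrite ltr_pMr ?exprn_gt0//; lra.
Qed.

Context (Xi : set 'rV[R]_d) (alpha s : R) (psi : 'rV[R]_d -> destination 'rV[R]_d).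
Hypotheses (d0 : (0 < d)%N) (s0 : 0 < s) (alpha0 : 0 < alpha).
Hypothesis alpha_le : alpha <= (s / d%:R) ^+ d.
Hypothesis Xi_lf : forall B, bounded_set B -> finite_set (Xi `&` B).
Hypothesis stab : stable_allocation Xi alpha%:E psi.

(** A site y closer to xi than a site claimed by xi is coveted by xi, so by stability
it does not desire xi. *)
Lemma ball_claimed x xi y : psi x = Center xi ->
  euclidean_dist y xi < euclidean_dist x xi -> psi y <> Undefined ->
  exists eta, [/\ Xi eta, psi y = Center eta
    & euclidean_dist y eta <= euclidean_dist y xi].
Proof.
move=> px yx py; have [[cen _ _ _] nst] := stab.
have Xxi := cen _ _ px.
have cov : covets alpha%:E psi xi y by left; exists x.
case E : (psi y) py => [eta| |]//= _; last first.
  by case: (nst y xi); split => //; rewrite /desires E.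
exists eta; split => //; first exact: cen E.
have [->//|/eqP eta_xi] := eqVneq eta xi.
rewrite leNgt; apply/negP => lt; case: (nst y xi); split => //.
- by rewrite E; case.
- by rewrite E.
- by rewrite /desires E.
Qed.

Lemma lebesgue_territories (A : set 'rV[R]_d) (t : seq 'rV[R]_d) :
  {in t, forall eta, Xi eta} ->
  (forall y, A y -> psi y <> Undefined -> exists2 eta, eta \in t & psi y = Center eta) ->
  (lebesgue A <= ((size t)%:R * alpha)%:E)%E.
Proof.
move=> tX At; have [[_ _ und terr] _] := stab.
apply: (@le_trans _ _ (lebesgue (\big[setU/set0]_(eta <- t) territory psi eta)
   + lebesgue (psi @^-1` [set Undefined]))%E).
  apply: le_trans (outer_measureU2 _ _ _); apply: le_outer_measure => y Ay.
  have [|py] := pselect (psi y = Undefined); [by right|left].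
  by have [eta et pe] := At y Ay py; rewrite -bigcup_seq; exists eta.
rewrite und adde0 {At}; elim: t tX => [|eta t IHt] tX.
  by rewrite big_nil outer_measure0 mul0r.
rewrite big_cons (le_trans (outer_measureU2 _ _ _))//= -natr1 mulrDl EFinD addeC.
rewrite leeD ?mul1r//; first by apply: terr; apply: tX; rewrite mem_head.
by apply: IHt => z zt; apply: tX; rewrite inE zt orbT.
Qed.

(** The ball of radius r around xi is filled by territories of centers within sup
distance 2r of xi, each of volume at most alpha, so the number of these centers is
at least the volume of the inscribed cube divided by alpha. If r < s the center
xi alone is enough. *)
Lemma claimed_crowded x xi : psi x = Center xi ->
  exists k (t : seq 'rV[R]_d), [/\ (0 < k)%N, uniq t, (k ^ d <= 2 ^ d * size t)%N
    & {in t, forall z, Xi z /\ forall i, `|z 0 i - x 0 i| < s * (3 * k)%:R}].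
Proof.
move=> px; have Xxi : Xi xi by have [[+ _ _ _] _] := stab; apply; exact: px.
set r := euclidean_dist x xi.
have r0 : 0 <= r by exact: sqrtr_ge0.
pose B : set 'rV[R]_d := [set z | forall i, `|z 0 i - xi 0 i| <= 2 * r].
have finB : finite_set (Xi `&` B).
  apply: Xi_lf; exists (`|xi| + 2 * r); split; first exact: num_real.
  move=> b ltb z Bz; apply: le_trans (ltW ltb).
  rewrite -[z](subrK xi) addrC (le_trans (ler_normD _ _))// lerD2l.
  by apply/rV_norm_le => [|i]; rewrite ?mulr_ge0// !mxE Bz.
pose t := enum_fset (fset_set (Xi `&` B)).
have tE z : z \in t <-> Xi z /\ B z by rewrite /t in_fset_set// inE.
have xit : xi \in t by apply/tE; split => // i; rewrite subrr normr0 mulr_ge0.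
pose k := (Num.truncn (r / s)).+1.
have rs0 : 0 <= r / s by rewrite divr_ge0// ltW.
have /andP[k_le k_gt] := Num.Theory.truncn_itv rs0.
have rk : r < s * k%:R by rewrite mulrC -ltr_pdivrMr.
exists k, t; split => //.
- exact: fset_uniq.
- have [rs|sr] := ltP r s.
    have -> : k = 1%N.
      by congr _.+1; apply/eqP; rewrite truncn_eq// ?mulr0n rs0 ltr_pdivrMr// mul1r.
    by rewrite exp1n muln_gt0 expn_gt0/=; move: xit; case: (t).
  have rgt0 : 0 < r by exact: lt_le_trans sr.
  (* the cube inscribed in the ball is covered by the territories of [t] *)
  pose c : 'rV[R]_d * 'rV[R]_d :=
    (\row_i (xi 0 i - r / (2 * d%:R)), \row_i (xi 0 i + r / (2 * d%:R))).
  have dR : 0 < d%:R :> R by rewrite ltr0n.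
  have vol : box_volume c = (r / d%:R) ^+ d.
    rewrite /box_volume (eq_bigr (fun => r / d%:R)) ?prodr_const ?card_ord// => i _.
    rewrite !mxE max_r; first by field; rewrite gt_eqF.
    rewrite subr_ge0 lerBlDr -addrA lerDl -mulr2n mulrn_wge0//.
    by rewrite divr_ge0// mulr_ge0// ltW.
  have cov : (lebesgue (box c) <= ((size t)%:R * alpha)%:E)%E.
    apply: lebesgue_territories => [z /tE[]//|y yc py].
    have yr : euclidean_dist y xi < r.
      by apply: euclidean_dist_lt => // i; have := yc i; rewrite !mxE ler_distl.
    have [eta [Xeta pe ye]] := ball_claimed px yr py; exists eta => //.
    apply/tE; split => // i.
    have := coord_le_euclidean_dist y eta i; have := coord_le_euclidean_dist y xi i.
    rewrite !ler_distl; lra.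
  have := le_trans (box_volume_le_lebesgue c) cov; rewrite vol lee_fin => {cov vol} H.
  have {}H : (r / d%:R) ^+ d <= (size t)%:R * (s / d%:R) ^+ d.
    by apply: le_trans H _; rewrite ler_wpM2l.
  rewrite !expr_div_n mulrA ler_pM2r ?invr_gt0 ?exprn_gt0// in H.
  have ks : k%:R * s <= 2 * r.
    rewrite /k -natr1 mulrDl mul1r.
    have : (Num.truncn (r / s))%:R * s <= r by rewrite -ler_pdivlMr.
    lra.
  rewrite -(ler_nat R) natrM !natrX -(ler_pM2r (exprn_gt0 d s0)) -exprMn.
  rewrite (@le_trans _ _ ((2 * r) ^+ d))//.
    by rewrite lerXn2r// nnegrE ?mulr_ge0// ltW.
  by rewrite exprMn -mulrA ler_wpM2l// exprn_ge0.
- move=> z /tE[Xz Bz]; split => // i; have := Bz i.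
  have := coord_le_euclidean_dist x xi i; rewrite -/r.
  by rewrite natrM mulrCA !ler_distl ltr_distl; lra.
Qed.

(** A site of the closure is at distance less than s from a claimed site, which costs
one more cell. *)
Lemma claimed_overcrowded y : claimed_sites Xi psi y ->
  overcrowded (cell s) Xi (cell s y).
Proof.
move=> Cy; have [|x [[xi Xxi px] yx]] := Cy (ball y s).
  exact: nbhsx_ballx.
have xy : (ldist (cell s x) (cell s y) <= 1)%N.
  apply: ldist_cell => // i; rewrite mulr1.
  move: yx; rewrite -ball_normE /= => yx.
  by have := rV_coord_le (y - x) i; rewrite !mxE distrC => /le_lt_trans; apply.
have [k [t [k0 ut kt tP]]] := claimed_crowded (esym px).
exists k, t; split => // z /tP[Xz zx]; split => //.
apply: (leq_trans (ldist_triangle (cell s x) _ _)).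
apply: (@leq_trans (3 * k + 1)); last by lia.
by apply: leq_add => //; apply: ldist_cell.
Qed.

End claimed_sites_are_overcrowded.

(** * A parity substitute for planar duality *)

Section planar_parity.
Local Open Scope nat_scope.
Implicit Types (u v : nat * nat) (a b : nat).

Definition rook u v : bool :=
  [|| (u.1.+1 == v.1) && (u.2 == v.2), (v.1.+1 == u.1) && (u.2 == v.2),
      (u.1 == v.1) && (u.2.+1 == v.2) | (u.1 == v.1) && (v.2.+1 == u.2)].

Definition planar_king u v : bool :=
  [&& u.1 <= v.1.+1, v.1 <= u.1.+1, u.2 <= v.2.+1 & v.2 <= u.2.+1].

Context (L B : nat * nat -> bool).

Definition boundary v : Prop := ~~ L v /\ exists2 u, rook u v & L u.

Let edge u v : bool := if L u then ~~ L v && B v else L v && B u.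

Hypothesis B_boundary : forall u v,
  boundary u -> boundary v -> planar_king u v -> B u = B v.

Lemma edge_boundary u v : rook u v -> L u -> ~~ L v -> boundary v.
Proof. by move=> uv Lu Lv; split => //; exists u. Qed.

(** Around a unit square the membership in L changes an even number of times. The
sites outside L at these changes lie on the boundary and are pairwise
king-adjacent, so B holds for all of them or for none. *)
Lemma square_parity a b :
  edge (a, b) (a.+1, b) (+) edge (a, b.+1) (a.+1, b.+1) =
  edge (a, b) (a, b.+1) (+) edge (a.+1, b) (a.+1, b.+1).
Proof.
set u1 := (a, b); set u2 := (a.+1, b); set u3 := (a.+1, b.+1); set u4 := (a, b.+1).
have R u v : rook u v -> (L u -> ~~ L v -> boundary v) * (L v -> ~~ L u -> boundary u).
  move=> uv; split; apply: edge_boundary => //.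
  by move: uv; rewrite /rook; lia.
have [b12 b21] : _ * _ := R u1 u2 ltac:(rewrite /rook /=; lia).
have [b23 b32] : _ * _ := R u2 u3 ltac:(rewrite /rook /=; lia).
have [b34 b43] : _ * _ := R u3 u4 ltac:(rewrite /rook /=; lia).
have [b41 b14] : _ * _ := R u4 u1 ltac:(rewrite /rook /=; lia).
have K u v : planar_king u v -> boundary u -> boundary v -> B u = B v.
  by move=> uv bu bv; exact: B_boundary.
have k12 := K u1 u2 ltac:(rewrite /planar_king /=; lia).
have k13 := K u1 u3 ltac:(rewrite /planar_king /=; lia).
have k14 := K u1 u4 ltac:(rewrite /planar_king /=; lia).
have k23 := K u2 u3 ltac:(rewrite /planar_king /=; lia).
have k24 := K u2 u4 ltac:(rewrite /planar_king /=; lia).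
have k34 := K u3 u4 ltac:(rewrite /planar_king /=; lia).
(* for each trace of L on the square, keep the equalities of B that it forces *)
rewrite /edge; clearbody u1 u2 u3 u4; clear R K.
case: (L u1) b12 b21 b41 b14; case: (L u2) b23 b32; case: (L u3) b34 b43;
  case: (L u4) => //= b34 b43 b23 b32 b12 b21 b41 b14;
  repeat match goal with
  | H : is_true true -> _ |- _ => move: (H isT) => {}H
  | H : is_true false -> _ |- _ => clear H
  | H : is_true (~~ true) -> _ |- _ => clear H
  | H : is_true (~~ false) -> _ |- _ => move: (H isT) => {}H
  | H : boundary ?u -> _, G : boundary ?u |- _ => move: (H G) => {}H
  end; move: k12 k13 k14 k23 k24 k34;
  case: (B u1); case: (B u2); case: (B u3); case: (B u4) => *;
  by [|congruence].
Qed.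

(** Count, modulo 2, the horizontal edges of a row across which one leaves L into B.
By [square_parity] consecutive rows have the same count, since nothing happens on
the two extreme columns. In row 0, where the whole boundary is in B, the count is
odd because L starts in and ends out. So no row is free of B. *)
Lemma parity_crossing W :
  (forall b, ~~ L (0, b) -> ~~ B (0, b)) -> (forall b, ~~ L (W, b)) ->
  (forall a, boundary (a, 0) -> B (a, 0)) -> L (0, 0) ->
  forall b, exists2 a, (a <= W) & B (a, b).
Proof.
move=> col0 colW row0 L00 b.
pose e V b := \big[addb/false]_(a < V) edge (a : nat, b) (a.+1, b).
have strip V c : e V c (+) e V c.+1 = edge (0, c) (0, c.+1) (+) edge (V, c) (V, c.+1).
  elim: V => [|V IHV]; first by rewrite /e !big_ord0 !addbb.
  rewrite /e !big_ord_recr /= -/(e V c) -/(e V c.+1) addbACA IHV square_parity.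
  by rewrite -addbA addKb.
have eW c : e W c.+1 = e W c.
  have vert0 : edge (0, c) (0, c.+1) = false.
    rewrite /edge; case: ifP => [_|/negbT nL].
      by apply/negbTE/nandP; case: (boolP (L _)) => [|/col0]; [left|right].
    by rewrite (negbTE (col0 _ nL)) andbF.
  have vertW : edge (W, c) (W, c.+1) = false.
    by rewrite /edge !(negbTE (colW _)).
  by have := strip W c; rewrite vert0 vertW; do 2 case: (e W _).
have rowE a : edge (a, 0) (a.+1, 0) = L (a, 0) (+) L (a.+1, 0).
  rewrite /edge; have r1 : rook (a, 0) (a.+1, 0) by rewrite /rook /= !eqxx.
  have r2 : rook (a.+1, 0) (a, 0) by rewrite /rook /= !eqxx orbT.
  case: ifP => La; case: (boolP (L (a.+1, 0))) => //= Lb.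
    by rewrite row0//; exact: (edge_boundary r1).
  by rewrite row0//; apply: (edge_boundary r2) => //; rewrite La.
have e0 V : e V 0 = L (0, 0) (+) L (V, 0).
  elim: V => [|V IHV]; first by rewrite /e big_ord0 addbb.
  by rewrite /e big_ord_recr /= -/(e V 0) IHV rowE addbA addbK.
have eb : e W b.
  by elim: b => [|c IHc]; [rewrite e0 L00 (negbTE (colW _))|rewrite eW].
have [a aW] : exists2 a, (a < W) & edge (a, b) (a.+1, b).
  apply: contraPP eb => H; apply/negP/negbT/big1 => a _.
  by apply: contra_notF H => eab; exists a.
rewrite /edge; case: ifP => _ /andP[_ Bab].
  by exists a.+1.
by exists a => //; exact: ltnW.
Qed.

End planar_parity.

(** * From short chains of bad cells to the two phases *)

Section bad_cells.
Context {d : nat} (bad : lattice d -> Prop).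

Definition bad_connected (q p : lattice d) : Prop :=
  exists w, [/\ path king q w, last q w = p & {in q :: w, forall a, bad a}].

Lemma bad_connected_refl q : bad q -> bad_connected q q.
Proof. by move=> bq; exists [::]; split => // a; rewrite inE => /eqP->. Qed.

Lemma bad_connected_step q p p' :
  bad_connected q p -> king p p' -> bad p' -> bad_connected q p'.
Proof.
move=> [w [qw wp bw]] pp' bp'; exists (rcons w p'); split.
- by rewrite rcons_path qw wp.
- by rewrite last_rcons.
- move=> a; rewrite -rcons_cons mem_rcons inE => /predU1P[->//|].
  exact: bw.
Qed.

(** The start q may be as far as 2n from the origin, twice the diameter bound: this
is what keeps a chain from (x, 0) off the vertical axis. *)
Definition short_bad_walks (n0 : nat) : Prop := forall n q p, (n0 <= n)%N ->
  bad_connected q p -> (ldist q 0 <= 2 * n)%N -> (ldist p q < n)%N.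

End bad_cells.

Lemma sparse_short_bad_walks (d : nat) (T : eqType) (cell : T -> lattice d)
    (X : T -> Prop) (J : nat) :
  (forall j, (J <= j)%N -> ~ crowded_walk cell X (5 * 34 ^ d * j) j) ->
  short_bad_walks (overcrowded cell X) (34 ^ d * J).
Proof.
move=> sparse n q p Jn [w [qw wp bw]] q0; rewrite ltnNge -wp; apply/negP => nq.
have [j nj cw] := overcrowded_path qw bw nq q0; apply: sparse cw.
have := leq_ltn_trans Jn nj; rewrite ltn_mul2l => /andP[_]; exact: ltnW.
Qed.

Lemma bounded_setS (R : realType) (d : nat) (A B : set 'rV[R]_d) :
  bounded_set B -> A `<=` B -> bounded_set A.
Proof.
by move=> [M [Mr MB]] AB; exists M; split => // b Mb x /AB; exact: (MB b Mb).
Qed.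

Section no_percolation.
Context {R : realType} {d : nat} (s : R) (C : set 'rV[R]_d).
Context (bad : lattice d -> Prop) (n0 : nat).
Hypotheses (s0 : 0 < s) (C_bad : forall y, C y -> bad (cell s y)).
Hypothesis short : short_bad_walks bad n0.

(** Sites of A at distance less than s lie in adjacent cells, so the sites of A whose
cell is joined to that of x by bad cells form a relatively clopen subset of A. *)
Lemma connected_bad_connected (A : set 'rV[R]_d) x y :
  connected A -> A `<=` C -> A x -> A y -> bad_connected bad (cell s x) (cell s y).
Proof.
move=> cA AC Ax Ay; pose U := [set z | A z /\ bad_connected bad (cell s x) (cell s z)].
have near z z' : A z -> A z' -> ball z s z' ->
    bad_connected bad (cell s x) (cell s z) -> bad_connected bad (cell s x) (cell s z').
  move=> Az Az' zz' xz; apply: bad_connected_step xz _ (C_bad (AC _ Az')).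
  apply: ldist_cell => // i; rewrite mulr1.
  move: zz'; rewrite -ball_normE /=; apply: le_lt_trans.
  by have := rV_coord_le (z - z') i; rewrite !mxE.
suff AU : A = U by have : U y; [rewrite -AU|case].
apply/esym/cA.
- by exists x; split => //; exact/bad_connected_refl/C_bad/AC.
- exists (\bigcup_(z in U) ball z s); first by apply: bigcup_open => z _; exact: ball_open.
  apply/seteqP; split => z.
    by move=> Uz; split; [case: Uz|exists z => //; exact: ballxx].
  by move=> [Az [z' [Az' xz'] zz']]; split => //; exact: near xz'.
- exists (~` \bigcup_(z in A `\` U) ball z s).
    by apply: open_closedC; apply: bigcup_open => z _; exact: ball_open.
  apply/seteqP; split => z.
    move=> [Az xz]; split => // -[z' [Az' nUz'] zz']; apply: nUz'; split => //.
    by apply: near xz => //; exact: ball_sym.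
  move=> [Az]; apply: contra_notP => nUz; exists z; last exact: ballxx.
  by split.
Qed.

Lemma connected_bounded (A : set 'rV[R]_d) :
  connected A -> A `<=` C -> bounded_set A.
Proof.
move=> cA AC; have [->|/set0P[x Ax]] := eqVneq A set0.
  by exists 0; split => // b _ z [].
pose n := maxn n0 (ldist (cell s x) 0).
apply: (bounded_setS (bounded_region (cube (cell s x) n) s0)) => y Ay.
rewrite /region /= mem_cube ltnW//; apply: (short (leq_maxl _ _)).
  exact: (connected_bad_connected cA AC Ax Ay).
by rewrite (leq_trans (leq_maxr n0 _))// leq_pmull.
Qed.

End no_percolation.

Section corners.
Context {R : realType} {d : nat}.
Implicit Types (s : R) (q : lattice d).

Definition corner s q : 'rV[R]_d := \row_i (s * (q 0 i)%:~R).

Lemma cell_corner s q : 0 < s -> cell s (corner s q) = q.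
Proof.
move=> s0; apply/eqP/cellP => // i; rewrite mxE lexx /= ltr_pM2l//.
by rewrite ltr_int ltrDl.
Qed.

(** The segment between the lower corners of two adjacent half-open cells stays in
their union. *)
Lemma connected_corners s (C : set 'rV[R]_d) (q q' : lattice d) (k : 'I_d) : 0 < s ->
  (forall i, q' 0 i = q 0 i + (i == k)%:Z) ->
  (forall x, C x -> cell s x != q /\ cell s x != q') ->
  connected_component (~` C) (corner s q) (corner s q').
Proof.
move=> s0 qq' Cqq'.
pose f (t : R) : 'rV[R]_d := corner s q + t *: \row_i (s * (i == k)%:R).
have fE t i : f t 0 i = s * ((q 0 i)%:~R + t * (i == k)%:R).
  by rewrite !mxE; ring.
have f0 : f 0 = corner s q by rewrite /f scale0r addr0.
have f1 : f 1 = corner s q'.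
  by apply/rowP => i; rewrite fE mxE qq' intrD mul1r.
exists (f @` `[0, 1]%classic); last first.
  by exists 1; rewrite ?f1//= in_itv/= ler01 lexx.
split.
- by exists 0; rewrite ?f0//= in_itv/= ler01 lexx.
- move=> _ [t /= + <-] Cft; rewrite in_itv/= => /andP[t0 t1].
  have [cq cq'] := Cqq' _ Cft.
  have [t_eq1|t_neq1] := eqVneq t 1.
    by move: cq'; rewrite t_eq1 f1 cell_corner// eqxx.
  move: cq => /negP; apply; apply/cellP => // i; rewrite fE.
  have t_lt1 : t < 1 by rewrite lt_neqAle t_neq1.
  rewrite ler_pM2l// ltr_pM2l// intrD.
  by case: (i == k); rewrite ?mulr1 ?mulr0; lra.
- apply: connected_continuous_connected; first exact: segment_connected.
  apply: continuous_subspaceT => t; apply: cvgD; first exact: cvg_cst.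
  by apply: cvgZr_tmp; exact: cvg_id.
Qed.

End corners.

Section plane.
Context {d : nat} (hd : (2 <= d)%N).
Implicit Types u v : nat * nat.

Definition plane u : lattice d :=
  \row_(i < d) if (i : nat) is k.+1 then (if k is 0%N then u.2%:Z else 0) else u.1%:Z.

Lemma ldist_planeP u v k :
  (ldist (plane u) (plane v) <= k)%N <->
  (`|(u.1%:Z - v.1%:Z)%R| <= k)%N /\ (`|(u.2%:Z - v.2%:Z)%R| <= k)%N.
Proof.
split => [/ldist_leP H|[H1 H2]].
  have := H (Ordinal (ltnW hd)); have := H (Ordinal hd).
  by rewrite !mxE /=.
by apply/ldist_leP => i; rewrite !mxE; case: (i : nat) => [//|[|k']] //; rewrite subrr.
Qed.

Lemma plane00 : plane (0, 0)%N = 0.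
Proof. by apply/rowP => i; rewrite !mxE; case: (i : nat) => [|[|]]. Qed.

Lemma ldist_plane0 u k : (ldist (plane u) 0 <= k)%N <-> (u.1 <= k)%N /\ (u.2 <= k)%N.
Proof. rewrite -plane00 ldist_planeP /=; move: u => [a b] /=; lia. Qed.

Lemma rook_plane u v : rook u v ->
  exists k : 'I_d, (forall i, plane v 0 i = plane u 0 i + (i == k)%:Z) \/
                   (forall i, plane u 0 i = plane v 0 i + (i == k)%:Z).
Proof.
move: u v => [a b] [a' b']; rewrite /rook /= => /or4P[]/andP[/eqP e1 /eqP e2]; subst.
- exists (Ordinal (ltnW hd)); left => i; rewrite !mxE -val_eqE /=.
  by case: (i : nat) => [|[|k]] /=; lia.
- exists (Ordinal (ltnW hd)); right => i; rewrite !mxE -val_eqE /=.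
  by case: (i : nat) => [|[|k]] /=; lia.
- exists (Ordinal hd); left => i; rewrite !mxE -val_eqE /=.
  by case: (i : nat) => [|[|k]] /=; lia.
- exists (Ordinal hd); right => i; rewrite !mxE -val_eqE /=.
  by case: (i : nat) => [|[|k]] /=; lia.
Qed.

End plane.

Section unbounded_component.
Context {R : realType} {d : nat} (hd : (2 <= d)%N) (s : R) (C : set 'rV[R]_d).
Context (bad : lattice d -> Prop) (n0 : nat).
Hypotheses (s0 : 0 < s) (C_bad : forall y, C y -> bad (cell s y)).
Hypothesis short : short_bad_walks bad n0.

Let good_corner (q : lattice d) : ~ bad q -> (~` C) (corner s q).
Proof. by move=> gq /C_bad; rewrite cell_corner. Qed.

Let good_step (q q' : lattice d) (k : 'I_d) : (forall i, q' 0 i = q 0 i + (i == k)%:Z) ->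
  ~ bad q -> ~ bad q' -> connected_component (~` C) (corner s q) (corner s q').
Proof.
move=> qq' gq gq'; apply: (connected_corners s0 qq') => x /C_bad bx.
by split; [apply: contra_notN gq|apply: contra_notN gq'] => /eqP <-.
Qed.

(** L gathers the cells of a large square and the good cells whose corner is connected
off C to a corner near that square; B gathers the bad cells chained to the positive
axis. If all components were bounded, L would be bounded and its boundary would be
bad, so [parity_crossing] would give cells of B at every height. But a chain
starting at (x, 0) has diameter less than about x/2, hence B stays strictly below
the diagonal. *)
Lemma unbounded_component :
  exists2 x, (~` C) x & ~ bounded_set (connected_component (~` C) x).
Proof.
apply: contrapT => noub.
have bnd q : ~ bad q -> bounded_set (connected_component (~` C) (corner s q)).
  move=> gq; apply: contrapT => ub; apply: noub.
  by exists (corner s q) => //; exact: good_corner.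
have /choice[M MP] : forall q, exists M : R, 0 <= M /\ (~ bad q ->
    forall y, connected_component (~` C) (corner s q) y -> `|y| <= M).
  move=> q; have [bq|gq] := pselect (bad q); first by exists 0.
  have [M [_ HM]] := bnd q gq; exists (`|M| + 1); split; first by rewrite addr_ge0.
  by move=> _ y qy; apply: HM qy; rewrite (le_lt_trans (ler_norm M))// ltrDl.
(* a chain from (x, 0) is controlled at scale x / 2, which must be at least n0 *)
pose n := (2 * n0)%N.
pose S := \sum_(q <- cube (0 : lattice d) n.+1) M q.
(* no component bounded by S reaches the column W of corners *)
pose W := (maxn n (Num.truncn (S / s))).+1.
have MS q : (ldist q 0 <= n.+1)%N -> M q <= S.
  move=> qn; rewrite /S (big_rem q) ?mem_cube//= lerDl.
  by apply: sumr_ge0 => q' _; have [] := MP q'.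
have SW : S < s * W%:R.
  rewrite -ltr_pdivrMl// mulrC (lt_le_trans (truncnS_gt _))// ler_nat.
  by rewrite /W ltnS leq_maxr.
pose L u := `[< (ldist (plane u) (0 : lattice d) <= n)%N \/ (~ bad (plane u) /\
  exists q, [/\ (ldist q 0 <= n.+1)%N, ~ bad q &
    connected_component (~` C) (corner s q) (corner s (plane u))]) >].
pose B u := `[< exists2 x, (n <= x)%N & bad_connected bad (plane (x, 0)%N) (plane u) >].
have bd_bad v : boundary L v -> bad (plane v).
  move=> [/negP nLv [u uv /asboolP Lu]]; apply: contrapT => gv; apply: nLv.
  apply/asboolP; right; split => //.
  have [k uvk] := rook_plane hd uv.
  case: Lu => [un|[gu [q [qn gq qu]]]].
    exists (plane v); split => //; last exact/connected_component_refl/good_corner.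
    apply/(ldist_plane0 hd); move/(ldist_plane0 hd): un; move: uv.
    by rewrite /rook; lia.
  exists q; split => //; apply: connected_component_trans qu _.
  case: uvk => [uvk|vuk]; first exact: good_step uvk _ _.
  exact/connected_component_sym/(good_step vuk).
have B_near a b : B (a, b) -> (b < a)%N.
  move=> /asboolP[x nx xab].
  have xm : (ldist (plane (x, 0)%N) (0 : lattice d) <= 2 * uphalf x)%N.
    by apply/(ldist_plane0 hd) => /=; lia.
  have n0x : (n0 <= uphalf x)%N by move: nx; rewrite /n; lia.
  have := short n0x xab xm; case xE : (uphalf x) => [//|m].
  by rewrite ltnS => /(ldist_planeP hd) /=; lia.
have [|b|b|a|//|a aW /B_near] := @parity_crossing L B _ W _ _ _ _ W.
- move=> u v bu bv uv; have buP := bd_bad _ bu; have bvP := bd_bad _ bv.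
  have uvk : king (plane u) (plane v : lattice d).
    by apply/(ldist_planeP hd); move: uv; rewrite /planar_king; lia.
  apply/asboolP/asboolP => -[x nx xw]; exists x => //.
    exact: bad_connected_step xw uvk bvP.
  by apply: bad_connected_step xw _ buP; rewrite king_sym.
- by move=> _; apply/negP => /B_near.
- apply/asboolP => -[/(ldist_plane0 hd)[/= Wn _]|[_ [q [qn gq qW]]]].
    by move: Wn; rewrite /W; lia.
  have [_ /(_ gq _ qW)] := MP q.
  have := rV_coord_le (corner s (plane (W, b))) (Ordinal (ltnW hd)).
  rewrite !mxE /= => H1 H2; have := le_trans H1 (le_trans H2 (MS _ qn)).
  rewrite ger0_norm ?mulr_ge0 ?(ltW s0)// => /le_lt_trans/(_ SW).
  by rewrite -pmulrn ltxx.
- move=> ba; apply/asboolP; exists a.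
    have [/asboolPn nL _] := ba; rewrite leqNgt; apply/negP => an; apply: nL; left.
    by apply/(ldist_plane0 hd) => /=; split; rewrite // ltnW.
  exact/bad_connected_refl/bd_bad.
- by apply/asboolP; left; rewrite plane00 ldistxx.
- by rewrite ltnNge aW.
Qed.

End unbounded_component.

(** * The percolation theorem *)

(** The side s is chosen before the appetite, and every appetite alpha with
alpha d^d <= s^d is admissible; the threshold on alpha therefore depends on the
dimension only. *)
Lemma ae_short_bad_walks (R : realType) (d : nat) : (0 < d)%N ->
  exists2 s : R, 0 < s &
  forall (disp : measure_display) (Omega : measurableType disp)
    (P : probability Omega R) (Xi : Omega -> set 'rV[R]_d)
    (psi : \bar R -> Omega -> 'rV[R]_d -> destination 'rV[R]_d) (alpha : R),
  stable_allocation_model P Xi psi -> 0 < alpha <= (s / d%:R) ^+ d ->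
  {ae P, forall w, exists (bad : lattice d -> Prop) (n0 : nat),
    short_bad_walks bad n0 /\
    forall y, claimed_sites (Xi w) (psi alpha%:E w) y -> bad (cell s y)}.
Proof.
move=> d0; have [s s0 sparse] := poisson_sparse R (5 * 34 ^ d) d0.
exists s => // disp Omega P Xi psi alpha [Poi stab] /andP[alpha0 alpha_le].
have alpha_ge0 : (0 <= alpha%:E)%E by rewrite lee_fin ltW.
apply: filterS2 (sparse _ _ _ _ Poi) (stab _ alpha_ge0) => w [J JP] stw.
exists (overcrowded (cell s) (Xi w)), (34 ^ d * J)%N; split.
  exact: sparse_short_bad_walks.
move=> y; apply: (claimed_overcrowded d0 s0 alpha0 alpha_le _ stw) => B bB.
by have [+ _ _] := Poi; apply.
Qed.

Theorem theorem1p1 (R : realType) (d : nat) (hd : (2 <= d)%N) :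
  (exists2 alpha0 : R, 0 < alpha0 &
    forall (disp : measure_display) (Omega : measurableType disp)
      (P : probability Omega R) (Xi : Omega -> set 'rV[R]_d)
      (psi : \bar R -> Omega -> 'rV[R]_d -> destination 'rV[R]_d),
    stable_allocation_model P Xi psi ->
    (0 < percolation_threshold P Xi psi)%E /\
    forall alpha : R, 0 < alpha < alpha0 ->
      {ae P, forall w, ~ percolation (Xi w) (psi alpha%:E w)}) /\
  (exists2 alpha1 : R, 0 < alpha1 &
    forall (disp : measure_display) (Omega : measurableType disp)
      (P : probability Omega R) (Xi : Omega -> set 'rV[R]_d)
      (psi : \bar R -> Omega -> 'rV[R]_d -> destination 'rV[R]_d),
    stable_allocation_model P Xi psi ->
    forall alpha : R, 0 < alpha < alpha1 ->
      {ae P, forall w, unbounded_unclaimed_component (Xi w) (psi alpha%:E w)}).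
Proof.
have [s s0 short] := @ae_short_bad_walks R d (ltnW hd).
have a0 : 0 < (s / d%:R) ^+ d by rewrite exprn_gt0// divr_gt0// ltr0n (ltnW hd).
split; exists ((s / d%:R) ^+ d) => // disp Omega P Xi psi model.
  have noperc alpha : 0 < alpha < (s / d%:R) ^+ d ->
      {ae P, forall w, ~ percolation (Xi w) (psi alpha%:E w)}.
    move=> /andP[alpha0 /ltW alpha_le].
    apply: filterS (short _ _ _ _ _ alpha model _); last by rewrite alpha0.
    move=> w [bad [n0 [sh Cbad]]] [A [AC cA]]; apply.
    exact: (connected_bounded s0 Cbad sh cA AC).
  split => //; pose alpha := (s / d%:R) ^+ d / 2.
  have alpha0 : 0 < alpha by rewrite divr_gt0.
  apply: (@lt_le_trans _ _ alpha%:E); first by rewrite lte_fin.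
  apply: ereal_sup_ubound; split; first by rewrite lee_fin ltW.
  have := noperc alpha; rewrite alpha0 ltr_pdivrMr// ltr_pMr// ltr1n => /(_ isT).
  apply: negligibleS => w [A [A0 AC cA ubA]] /=.
  by apply: contrapT => H; apply: H; case; exists A.
move=> alpha /andP[alpha0 /ltW alpha_le].
apply: filterS (short _ _ _ _ _ alpha model _); last by rewrite alpha0.
by move=> w [bad [n0 [sh Cbad]]]; exact: (unbounded_component hd s0 Cbad sh).
Qed.
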